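(* Let $G$ be a non-trivial linearly ordered group, let $A$ be a non-empty shift-set in $G$, and let $a,b,c,d$ be arbitrary elements of $A$. Then for $(x,y)\in\mathscr{B}(A)$ the following hold: (i) $(a,b)=(a,c)(x,y)$ if and only if $(c,b)\preccurlyeq(x,y)$ in $\mathscr{B}(A)$; (ii) $(a,b)=(x,y)(d,b)$ if and only if $(a,d)\preccurlyeq(x,y)$ in $\mathscr{B}(A)$; (iii) $(a,b)=(a,c)(x,y)(d,b)$ if and only if $(c,d)\preccurlyeq(x,y)$ in $\mathscr{B}(A)$.
   Context: A linearly ordered group is a group $(G,\cdot)$ with a total order $\leqslant$ such that $a\leqslant b$ implies $a\cdot g\leqslant b\cdot g$ and $g\cdot a\leqslant g\cdot b$ for all $a,b,g\in G$. A subset $A\subseteq G$ is a shift-set if for any $x,y,z\in A$ with $y<x$ one has $x\cdot y^{-1}\cdot z\in A$. For a non-empty shift-set $A$, $\mathscr{B}(A)$ is the semigroup with underlying set $A\times A$ and the (associative) operation $$(a,b)(c,d)=\begin{cases}(c\cdot b^{-1}\cdot a,\,d), & b<c;\\ (a,d), & b=c;\\ (a,\,b\cdot c^{-1}\cdot d), & b>c.\end{cases}$$ $\mathscr{B}(A)$ is an inverse semigroup; the inverse of $(a,b)$ is $(b,a)$, and its idempotents are the pairs $(a,a)$, $a\in A$. On an inverse semigroup $S$ the natural partial order is defined by $s\preccurlyeq t$ iff $s=\varepsilon t$ for some idempotent $\varepsilon\in S$. *)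

(* Defs.v *)
From HB Require Import structures.
From mathcomp Require Import all_boot all_order.
From mathcomp Require Import boolp classical_sets.

Set Implicit Arguments.
Unset Strict Implicit.
Unset Printing Implicit Defensive.

Import Order.TTheory.

Local Open Scope group_scope.
Local Open Scope order_scope.
Local Open Scope classical_set_scope.

HB.mixin Record Group_isLinearlyOrdered (d : Order.disp_t) G
    of Group G & Order.Total d G := {
  le_mul2r : forall a b g : G, a <= b -> a * g <= b * g;
  le_mul2l : forall a b g : G, a <= b -> g * a <= g * b
}.

#[short(type="orderedGroupType")]
HB.structure Definition OrderedGroup (d : Order.disp_t) :=
  { G of Group G & Order.Total d G & Group_isLinearlyOrdered d G }.

HB.mixin Record Semigroup_isInverse S of Semigroup S := {
  inverse_ex_unique :
    forall s : S, exists! t : S, s * t * s = s /\ t * s * t = t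
}.

#[short(type="inverseSemigroupType")]
HB.structure Definition InverseSemigroup :=
  { S of Semigroup S & Semigroup_isInverse S }.

Definition natural_le (S : inverseSemigroupType) (s t : S) : Prop :=
  exists2 e : S, e * e = e & s = e * t.

Section ShiftSet.
Context {d : Order.disp_t} {G : orderedGroupType d}.

Definition shift_set (A : set G) : Prop :=
  forall x y z : G, A x -> A y -> A z -> y < x -> A (x * y^-1 * z).

Record shiftSet := ShiftSet {
  shift_carrier :> set G;
  shift_carrierP : shift_set shift_carrier
}.

End ShiftSet.

Arguments shiftSet {d} G.

Section BSemigroup.
Context {d : Order.disp_t} {G : orderedGroupType d}.
Implicit Type A : shiftSet G.

(* [shift x y z] is x * y^-1 * z as an element of A. The default value z of
   [insubd] is never reached when y < x, see [val_shift]. *)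
Definition shift A (x y z : A) : A := insubd z (val x * (val y)^-1 * val z).

Lemma val_shift A (x y z : A) :
  val y < val x -> val (shift x y z) = val x * (val y)^-1 * val z.
Proof.
move=> yx; rewrite val_insubd; case: ifPn => // /negP[].
by apply/mem_set/(shift_carrierP _ _ _ yx); apply/set_mem/valP.
Qed.

Definition Bsemigroup A : Type := (A * A)%type.

Definition Bpair A (a b : A) : Bsemigroup A := (a, b).

Definition Bmul A (p q : Bsemigroup A) : Bsemigroup A :=
  let: (a, b) := p in
  let: (c, d) := q in
  if val b < val c then Bpair (shift c b a) d
  else if b == c then Bpair a d
  else Bpair a (shift b c d).

Lemma max_mulr (x y g : G) : Order.max x y * g = Order.max (x * g) (y * g).
Proof.
case: (leP x y) => [xy|/ltW yx].
  by rewrite max_r // le_mul2r.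
by rewrite max_l // le_mul2r.
Qed.

(* With m = max(b, c), the three cases of the product (a, b) (c, d) combine
   into (m * b^-1 * a, m * c^-1 * d). *)
Lemma BmulE A (p q : Bsemigroup A) (m := Order.max (val p.2) (val q.1)) :
  (val (Bmul p q).1 = m * (val p.2)^-1 * val p.1) *
  (val (Bmul p q).2 = m * (val q.1)^-1 * val q.2).
Proof.
rewrite {}/m /Bmul /Bpair; case: p q => [a b] [b' c]; rewrite [_.2]/= [_.1]/=.
case: (eqVneq b b') => [->|neq_bb'].
  by rewrite ltxx maxxx !mulgV !mul1g.
case: ltgtP => [lt_bb'|lt_b'b|/val_inj e]; last by rewrite e eqxx in neq_bb'.
- by split; rewrite ?mulgV ?mul1g //; apply: val_shift.
- by split; rewrite ?mulgV ?mul1g //; apply: val_shift.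
Qed.

Lemma Bsemigroup_inj A (p q : Bsemigroup A) :
  val p.1 = val q.1 -> val p.2 = val q.2 -> p = q.
Proof. by case: p q => [a b] [c e] /= /val_inj-> /val_inj->. Qed.

Lemma BmulA A : associative (@Bmul A).
Proof.
move=> p q r.
have k : Order.max (val p.2) (val (Bmul q r).1) =
    Order.max (val (Bmul p q).2) (val r.1) * (val q.2)^-1 * val q.1.
  by rewrite !BmulE !max_mulr !mulgK mulgVK mulgV mul1g mulgVK maxA.
apply: Bsemigroup_inj.
- by rewrite [in LHS]BmulE k [in RHS]BmulE !BmulE
     !invgM !invgK !mulgA !mulgVK.
- by rewrite [in LHS]BmulE k [in RHS]BmulE !BmulE
     !invgM !invgK !mulgA !mulgK !mulgVK.
Qed.

HB.instance Definition _ A := Choice.on (Bsemigroup A).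
HB.instance Definition _ A := isSemigroup.Build (Bsemigroup A) (@BmulA A).

Lemma BmulP A (p q : Bsemigroup A) (m := Order.max (val p.2) (val q.1)) :
  (val (p * q).1 = m * (val p.2)^-1 * val p.1) *
  (val (p * q).2 = m * (val q.1)^-1 * val q.2).
Proof. exact: BmulE. Qed.

Lemma Binverse_uniq A (p q : Bsemigroup A) :
  p * q * p = p /\ q * p * q = q <-> q = Bpair p.2 p.1.
Proof.
have max_le (x y z : G) : Order.max x y * y^-1 * z = z -> x <= y.
  move=> e; rewrite -[leRHS]mul1g -(mulgV z) -{1}e mulgK mulgVK.
  by rewrite le_max lexx.
have le_q2p1 (s t : Bsemigroup A) : s * t * s = s -> val t.2 <= val s.1.
  move=> sts; have [_] := BmulP (s * t) s; rewrite sts => /esym /max_le.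
  apply: le_trans; rewrite BmulP -[leLHS]mul1g; apply: le_mul2r.
  by rewrite -(mulgV (val t.1)); apply: le_mul2r; rewrite le_max lexx orbT.
have inv (s : Bsemigroup A) : s * Bpair s.2 s.1 * s = s.
  apply: Bsemigroup_inj; rewrite !BmulP !maxxx ?mulgV ?mul1g ?maxxx.
    by rewrite mulgV mul1g.
  by rewrite mulgV mul1g.
split=> [[pqp qpq]|->]; last first.
  by split; [apply: inv | case: p => a b; apply: (inv (Bpair b a))].
have le1 := le_q2p1 _ _ pqp; have le2 := le_q2p1 _ _ qpq.
have max_eq (x y z : G) : x * y^-1 * z = z -> x = y.
  by move=> e; rewrite -[RHS]mul1g -(mulgV z) -{1}e mulgK mulgVK.
have [e1 e2] := BmulP (p * q) p; rewrite pqp in e1 e2.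
have m_p1 := max_eq _ _ _ (esym e2); rewrite m_p1 !BmulP in e1.
have {}e1 : val p.1 * (val q.2)^-1 = val p.2 * (val q.1)^-1.
  rewrite !invgM !invgK !mulgA mulgVK in e1.
  move/(congr1 ( *%g^~ (val p.1)^-1)): e1; rewrite mulgV mulgK => e1.
  have := congr1 ( *%g^~ (val p.2 * (val q.1)^-1)) e1.
  by rewrite mul1g !mulgA mulgVK mulgK => <-.
have q1p2 : val q.1 = val p.2.
  apply/eqP; rewrite eq_le le2 andbT.
  have := le_mul2r _ _ (val q.2)^-1 le1; rewrite mulgV e1.
  by move/(le_mul2r _ _ (val q.1)); rewrite mul1g mulgVK.
apply: Bsemigroup_inj => //; move: e1; rewrite q1p2 mulgV.
by move/(congr1 ( *%g^~ (val q.2))); rewrite mulgVK mul1g.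
Qed.

Lemma Binverse_ex_unique A (p : Bsemigroup A) :
  exists! q : Bsemigroup A, p * q * p = p /\ q * p * q = q.
Proof.
exists (Bpair p.2 p.1); split; first exact/Binverse_uniq.
by move=> q /Binverse_uniq.
Qed.

HB.instance Definition _ A :=
  Semigroup_isInverse.Build (Bsemigroup A) (@Binverse_ex_unique A).

End BSemigroup.

(* Main.v *)
Require Import Defs.
From mathcomp Require Import all_boot all_order.
From mathcomp Require Import boolp classical_sets.

(** The idempotents of B(A) are the pairs (p, p), and (p, p) (x, y) is
    (m, m x^-1 y) with m = max(p, x).  So the elements below (x, y) are the
    pairs (g x, g y) of elements of A with g >= 1 in G: this is [natural_leP],
    where g is the common value of u.1 t.1^-1 and u.2 t.2^-1.  Since x <= g x
    and y <= g y both amount to g >= 1, the inequality can be tested on either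
    coordinate ([natural_leP2]).

    In the product (a, c) t the first coordinate is m c^-1 a with
    m = max(c, t.1); it is a exactly when t.1 <= c, and then the second
    coordinate is c t.1^-1 t.2.  Hence (a, b) = (a, c) t says that
    (c, b) = (g t.1, g t.2) with g = c t.1^-1 >= 1, which is (i).  Part (ii) is
    the mirror image, with g tested on the second coordinate.  Part (iii) is
    (ii) for the element (a, c) t: in the criterion for (a, d) to be below
    (a, c) t, the factors m and a cancel and leave the criterion for (c, d) to
    be below t. *)

Set Implicit Arguments.
Unset Strict Implicit.
Unset Printing Implicit Defensive.

Import Order.TTheory.

Local Open Scope group_scope.
Local Open Scope order_scope.

Section OrderedGroup.
Context {d : Order.disp_t} {G : orderedGroupType d}.
Implicit Types x y g : G.

Lemma ler_mul2r g x y : (x * g <= y * g) = (x <= y).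
Proof.
apply/idP/idP; last exact: le_mul2r.
by move/(le_mul2r _ _ g^-1); rewrite !mulgK.
Qed.

Lemma le_divg x y : (x <= y) = (1 <= y * x^-1).
Proof. by rewrite -(ler_mul2r x^-1) mulgV. Qed.

Lemma divgKl_eq x y g : x * y^-1 * g = g <-> x = y.
Proof.
split=> [|->]; last by rewrite mulgV mul1g.
by rewrite -{2}[g]mul1g => /mulIg; rewrite -(mulgV y) => /mulIg.
Qed.

Lemma eq_mulgVM x y g h : x = g * h^-1 * y <-> g * h^-1 = x * y^-1.
Proof. by split=> [->|->]; rewrite ?mulgK ?mulgVK. Qed.

End OrderedGroup.

Section NaturalOrder.
Context {d : Order.disp_t} {G : orderedGroupType d} {A : shiftSet G}.
Implicit Types (a b c : A) (e s t u : Bsemigroup A).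

Lemma Bsemigroup_eqP s t : s = t <-> val s.1 = val t.1 /\ val s.2 = val t.2.
Proof. by split=> [->|[]] //; apply: Bsemigroup_inj. Qed.

(** An idempotent is its own inverse, and inversion swaps the coordinates. *)
Lemma idempotentP e : e * e = e <-> e.1 = e.2.
Proof.
split=> [ee|e12].
  by have /Binverse_uniq/(congr1 fst) : e * e * e = e /\ e * e * e = e by rewrite !ee.
by apply: Bsemigroup_inj; rewrite !BmulP e12 maxxx mulgV mul1g.
Qed.

(** The elements below [t] are the left translates of [t] by a group element
    [>= 1]. *)
Lemma natural_leP u t :
  natural_le u t <->
  val t.1 <= val u.1 /\ val u.1 * (val t.1)^-1 = val u.2 * (val t.2)^-1.
Proof.
split=> [[e /idempotentP e12 ->]|[le_tu u12]].
  by rewrite !BmulP e12 mulgVK mulgK le_max lexx orbT.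
(* [u = e * t] forces [e * u = u], and any smaller idempotent that still fixes
   [u] works as well; the least one is [(u.1, u.1)]. *)
exists (Bpair u.1 u.1); first exact/idempotentP.
apply: Bsemigroup_inj; rewrite !BmulP /= max_l //; first by rewrite mulgVK.
exact/eq_mulgVM.
Qed.

Lemma natural_leP2 u t :
  natural_le u t <->
  val t.2 <= val u.2 /\ val u.1 * (val t.1)^-1 = val u.2 * (val t.2)^-1.
Proof.
rewrite natural_leP (le_divg (val t.1)) (le_divg (val t.2)).
by split=> -[+ u12]; rewrite u12.
Qed.

(** Left multiplication by [(a, c)] keeps [a] as first coordinate exactly when
    [t.1 <= c]. *)
Lemma Bpair_eq_mull a b c t :
  Bpair a b = Bpair a c * t <-> natural_le (Bpair c b) t.
Proof.
rewrite Bsemigroup_eqP natural_leP !BmulP /=; split=> [[]|[le_tc cb]].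
  move=> /esym/divgKl_eq max_c; rewrite max_c => /eq_mulgVM.
  by split=> //; rewrite -max_c le_max lexx orbT.
rewrite max_l //; split; last exact/eq_mulgVM.
exact/esym/divgKl_eq.
Qed.

(** The mirror image of [Bpair_eq_mull]: here the second coordinate stays [b]
    exactly when [t.2 <= c], which is why the order has to be tested on second
    coordinates. *)
Lemma Bpair_eq_mulr a b c t :
  Bpair a b = t * Bpair c b <-> natural_le (Bpair a c) t.
Proof.
rewrite Bsemigroup_eqP natural_leP2 !BmulP /=; split=> [[]|[le_tc ac]].
  move=> a_eq /esym/divgKl_eq max_c; move: a_eq.
  rewrite max_c => /eq_mulgVM ->.
  by split=> //; rewrite -max_c le_max lexx.
rewrite max_r //; split; last exact/esym/divgKl_eq.
exact/eq_mulgVM/esym.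
Qed.

(** With [m = max (c, t.1)], the first coordinate [m c^-1 a] of the product is
    at most [a] exactly when [t.1 <= c]; in the equality of quotients [a] and
    [m] cancel. *)
Lemma natural_le_mull a b c t :
  natural_le (Bpair a b) (Bpair a c * t) <-> natural_le (Bpair c b) t.
Proof.
rewrite !natural_leP !BmulP /=; set m := Order.max _ _.
have -> : (m * (val c)^-1 * val a <= val a) = (val t.1 <= val c).
  by rewrite -[leRHS]mul1g ler_mul2r -(mulgV (val c)) ler_mul2r ge_max lexx.
rewrite !invgM !invgK !mulgA mulgV mul1g.
split=> -[le_tc cb]; split=> //.
  by rewrite (mulIg _ _ _ cb) mulgK.
by rewrite -cb mulgVK.
Qed.

End NaturalOrder.

Theorem proposition2p3 (disp : Order.disp_t) (G : orderedGroupType disp)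
    (G_nontrivial : exists g : G, g <> 1%g)
    (A : shiftSet G) (A_nonempty : exists g : G, shift_carrier A g)
    (a b c d x y : A) :
  (Bpair a b = (Bpair a c * Bpair x y)%g
     <-> natural_le (Bpair c b) (Bpair x y)) /\
  (Bpair a b = (Bpair x y * Bpair d b)%g
     <-> natural_le (Bpair a d) (Bpair x y)) /\
  (Bpair a b = (Bpair a c * Bpair x y * Bpair d b)%g
     <-> natural_le (Bpair c d) (Bpair x y)).
Proof.
split; first exact: Bpair_eq_mull.
split; first exact: Bpair_eq_mulr.
by rewrite Bpair_eq_mulr natural_le_mull.
Qed.
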